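(* Let $\mathcal{H}$ be an infinite-dimensional separable Hilbert space. Assertion (M2) below implies assertion (C) below. (M2) For every unconditionally convergent multiplier $M_{m,\Phi,\Psi}$ on $\mathcal{H}$ which is invertible on $\mathcal{H}$, with $\Phi=(\varphi_n)$ and $\Psi=(\psi_n)$ sequences in $\mathcal{H}$ and $m=(m_n)\subset\mathbb{C}$, there exist $(\alpha_n)\subset\mathbb{C}$ and $(\beta_n)\subset\mathbb{C}$ such that $(\alpha_n\varphi_n)$ and $(\beta_n\psi_n)$ are frames for $\mathcal{H}$ and $\alpha_n\overline{\beta_n}=m_n$ for all $n$. (C) Every sequence $(f_n)$ in $\mathcal{H}$ has the following property: $(f_n)$ is a weighted frame for $\mathcal{H}$ if and only if there is a sequence $(g_n)$ in $\mathcal{H}$ such that for every $f\in\mathcal{H}$ one has $f=\sum_n\langle f,f_n\rangle g_n$ with unconditional convergence.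
   Context: The scalars are complex and all sequences are indexed by $\mathbb{N}$. For sequences $\Phi=(\varphi_n)$, $\Psi=(\psi_n)$ in $\mathcal{H}$ and a complex sequence $m=(m_n)$ (the symbol), the multiplier $M_{m,\Phi,\Psi}$ is the operator $M_{m,\Phi,\Psi}f=\sum_n m_n\langle f,\psi_n\rangle\varphi_n$, defined for those $f\in\mathcal{H}$ for which the series converges. It is called unconditionally convergent if the series converges unconditionally for every $f\in\mathcal{H}$ (a multiplier defined on all of $\mathcal{H}$ is automatically bounded). Invertible on $\mathcal{H}$ means being a bounded bijective operator from $\mathcal{H}$ onto $\mathcal{H}$. A sequence $(f_n)$ in $\mathcal{H}$ is a frame for $\mathcal{H}$ if there are $A,B\in(0,\infty)$ with $A\|f\|^2\le\sum_n|\langle f,f_n\rangle|^2\le B\|f\|^2$ for all $f\in\mathcal{H}$. It is a weighted frame for $\mathcal{H}$ if there exists $(\omega_n)\subset(0,+\infty)$ such that $(\omega_nf_n)$ is a frame for $\mathcal{H}$. *)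

(* Defs.v *)
(* The complex numbers are [R[i]] for an arbitrary [R : realType]. A complex
   Hilbert space is a [completeNormedModType R[i]] together with a definite
   hermitian form [dot : {dot H for Num.conj}] that induces its norm. *)
From HB Require Import structures.
From mathcomp Require Import all_boot all_order all_algebra.
From mathcomp Require Import all_classical all_reals all_analysis.
From mathcomp Require Import complex.

Set Implicit Arguments.
Unset Strict Implicit.
Unset Printing Implicit Defensive.

Import Order.TTheory GRing.Theory Num.Theory.
Import numFieldNormedType.Exports.

Local Open Scope classical_set_scope.
Local Open Scope complex_scope.
Local Open Scope ring_scope.

(* Norms over [R[i]] take values in [R[i]], with zero imaginary part; [rnorm]
   is the same norm with values in [R]. It also applies to scalars. *)
Definition rnorm (R : realType) (V : normedZmodType R[i]) (x : V) : R :=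
  complex.Re `|x|.

(* [dot] is linear in its first argument, conjugate-linear in its second. *)
Definition induces_norm (R : realType) (H : normedModType R[i])
    (dot : {dot H for Num.conj}) : Prop :=
  forall x : H, `|x| ^+ 2 = dot x x.

Definition separable (T : topologicalType) : Prop :=
  exists S : set T, countable S /\ dense S.

Definition finite_dimensional (K : fieldType) (V : lmodType K) : Prop :=
  exists (n : nat) (e : 'I_n -> V),
    forall x : V, exists c : 'I_n -> K, x = \sum_(i < n) c i *: e i.

Definition unconditionally_convergent (K : numFieldType)
    (V : normedModType K) (u : nat -> V) : Prop :=
  forall s : nat -> nat, bijective s -> cvgn (series (u \o s)).

Definition invertible_operator (R : realType) (H : normedModType R[i])
    (T : H -> H) : Prop :=
  [/\ linear T,
      exists M : R, forall x : H, rnorm (T x) <= M * rnorm x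
    & bijective T].

Section HilbertSpace.
Context (R : realType) (H : completeNormedModType R[i]).
Context (dot : {dot H for Num.conj}).

(* The sum is taken in the extended reals, so that it exists even when the
   series diverges. *)
Definition frame (f : nat -> H) : Prop :=
  exists A B : R, [/\ 0 < A, 0 < B &
    forall x : H,
      ((A * rnorm x ^+ 2)%:E <= \sum_(0 <= n <oo) (rnorm (dot x (f n)) ^+ 2)%:E
       /\ \sum_(0 <= n <oo) (rnorm (dot x (f n)) ^+ 2)%:E
          <= (B * rnorm x ^+ 2)%:E)%E].

Definition weighted_frame (f : nat -> H) : Prop :=
  exists w : nat -> R,
    (forall n, 0 < w n) /\ frame (fun n => (w n)%:C *: f n).

Definition multiplier_term (m : nat -> R[i]) (phi psi : nat -> H) (x : H)
    (n : nat) : H :=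
  (m n * dot x (psi n)) *: phi n.

(* Meaningful only at those [x] for which the series converges: [limn] has a
   default value elsewhere. *)
Definition multiplier (m : nat -> R[i]) (phi psi : nat -> H) (x : H) : H :=
  limn (series (multiplier_term m phi psi x)).

Definition unconditionally_convergent_multiplier (m : nat -> R[i])
    (phi psi : nat -> H) : Prop :=
  forall x : H, unconditionally_convergent (multiplier_term m phi psi x).

End HilbertSpace.

(* Main.v *)
(* If [f] is reproduced by [g] with unconditional convergence, then the
   multiplier with symbol 1 is the identity, so the hypothesis yields
   [alpha_n * conj beta_n = 1]; hence [beta_n] is nonzero and the moduli
   [|beta_n|] are weights making [f] a frame. Conversely, if [h = w f] is a
   frame, its frame operator [S] is coercive, so [1 - t S] is a contraction for
   small [t]; hence [S] is invertible and [g_n = w_n S^-1 h_n] reproduces [f].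
   Bessel's inequality gives the unconditional convergence. *)
Require Import Defs.
From HB Require Import structures.
From mathcomp Require Import all_boot all_order all_algebra.
From mathcomp Require Import all_classical all_reals all_analysis.
From mathcomp Require Import complex ring lra.

Set Implicit Arguments.
Unset Strict Implicit.
Unset Printing Implicit Defensive.

Import Order.TTheory GRing.Theory Num.Theory.
Import numFieldNormedType.Exports.

Local Open Scope classical_set_scope.
Local Open Scope complex_scope.
Local Open Scope ring_scope.

(** * Norms with values in [R] *)

Section RealNorm.
Context (R : realType) (V : normedZmodType R[i]).
Implicit Types x y : V.

Lemma normE x : `|x| = (rnorm x)%:C.
Proof. by rewrite /rnorm RRe_real// ger0_real. Qed.

Lemma rnorm_ge0 x : 0 <= rnorm x.
Proof. by rewrite -ler0c -normE. Qed.

Lemma rnormD x y : rnorm (x + y) <= rnorm x + rnorm y.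
Proof. by rewrite -lecR rmorphD/= -!normE ler_normD. Qed.

Lemma rnormN x : rnorm (- x) = rnorm x.
Proof. by rewrite /rnorm normrN. Qed.

Lemma rnorm0 : rnorm (0 : V) = 0.
Proof. by rewrite /rnorm normr0. Qed.

Lemma rnorm_eq0 x : rnorm x = 0 -> x = 0.
Proof. by move=> x0; apply/normr0_eq0; rewrite normE x0. Qed.

Lemma rnorm_sum (I : Type) (s : seq I) (u : I -> V) :
  rnorm (\sum_(i <- s) u i) <= \sum_(i <- s) rnorm (u i).
Proof.
elim: s => [|i s ih]; first by rewrite !big_nil rnorm0.
by rewrite !big_cons (le_trans (rnormD _ _))// lerD2l.
Qed.

End RealNorm.

Section RealNormComplex.
Context (R : realType).
Implicit Types z w : R[i].

Lemma rnormM z w : rnorm (z * w) = rnorm z * rnorm w.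
Proof.
by apply: complexI; rewrite rmorphM/= -!normE normrM.
Qed.

Lemma rnorm_conj z : rnorm (Num.conj z) = rnorm z.
Proof. by rewrite /rnorm norm_conjC. Qed.

Lemma rnorm_real (a : R) : 0 <= a -> rnorm a%:C = a.
Proof. by move=> a0; rewrite /rnorm ger0_norm// ler0c. Qed.

Lemma Re_le_rnorm z : complex.Re z <= rnorm z.
Proof.
by rewrite (le_trans (ler_norm _))// -lecR -normE normc_ge_Re.
Qed.

Lemma ReMr (a : R) z : complex.Re (a%:C * z) = a * complex.Re z.
Proof. by case: z => b c /=; rewrite mul0r subr0. Qed.

Lemma Re_conj z : complex.Re (Num.conj z) = complex.Re z.
Proof. by case: z. Qed.

End RealNormComplex.

(** * Convergence in norm and summability criteria *)

Section Normed.
Context (R : realType) (V : normedModType R[i]).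

Lemma cvgn_rnormP (u : nat -> V) (l : V) :
  u @ \oo --> l <->
  forall e : R, 0 < e -> \forall n \near \oo, rnorm (l - u n) < e.
Proof.
split=> [/cvgrPdist_lt ul e e0|ul].
  have := ul e%:C; rewrite ltcR => /(_ e0).
  by apply: filterS => n; rewrite normE ltcR.
apply/cvgrPdist_lt => e e0.
(* Positive elements of [R[i]] are real, so [e] comes from [R]. *)
have eE : e = (complex.Re e)%:C by rewrite RRe_real// gtr0_real.
have /ul : 0 < complex.Re e by rewrite -ltcR -eE.
by apply: filterS => n; rewrite -ltcR -normE -eE.
Qed.

Lemma rnorm_lim_le (u : nat -> V) (l : V) (M : R) :
  u @ \oo --> l -> (forall n, rnorm (u n) <= M) -> rnorm l <= M.
Proof.
move=> /cvgn_rnormP ul uM; apply/ler_addgt0Pr => e /ul [n _ /(_ _ (leqnn n))] le.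
rewrite -(subrK (u n) l) (le_trans (rnormD _ _))// addrC lerD ?uM// ltW//.
Qed.

End Normed.

(* Bounding the square suits both uses: Bessel's inequality for the synthesis
   of a square-summable sequence, and a geometric series. *)
Lemma cvgn_series_le_sqr (R : realType) (H : completeNormedModType R[i])
    (u : nat -> H) (a : nat -> R) (M C : R) :
  (forall n, 0 <= a n) -> (forall n, \sum_(0 <= k < n) a k <= M) ->
  (forall m n, rnorm (\sum_(m <= k < n) u k) ^+ 2
     <= C * \sum_(m <= k < n) a k) ->
  cvgn (series u).
Proof.
move=> a0 aM uC.
have : cvgn (series a).
  apply: nondecreasing_is_cvgn.
    apply/nondecreasing_seqP => n.
    by rewrite /series/= big_nat_recr//= lerDl.
  by exists M => _ [n _ <-]; exact: aM.
move=> /cauchy_cvgP/cauchy_seriesP ca.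
apply/cauchy_cvgP/cauchy_seriesP => e e0.
have eE : e = (complex.Re e)%:C by rewrite RRe_real// gtr0_real.
have r0 : 0 < complex.Re e by rewrite -ltcR -eE.
(* [|C| + 1] is positive whatever the sign of [C], hence safe to divide by. *)
have K0 : 0 < `|C| + 1 by rewrite ltr_wpDl.
have /ca : 0 < complex.Re e ^+ 2 / (`|C| + 1) by rewrite divr_gt0// exprn_gt0.
apply: filterS => -[m n] /=; rewrite ger0_norm ?sumr_ge0// => sa.
rewrite normE eE ltcR -(@ltr_pXn2r _ 2)// ?nnegrE ?rnorm_ge0 ?ltW//.
apply: le_lt_trans (uC m n) _.
rewrite -[ltRHS](divfK (lt0r_neq0 K0)) mulrC.
apply: le_lt_trans (_ : (\sum_(m <= k < n) a k) * (`|C| + 1) < _).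
  apply: ler_wpM2l; first exact: sumr_ge0.
  by rewrite (le_trans (ler_norm _))// lerDl.
by rewrite ltr_pM2r.
Qed.

(** A finite set of indices lies in an initial segment, and the terms are nonnegative. This passes
    from partial sums to permuted ones. *)
Lemma ler_sum_uniq (R : realType) (a : nat -> R) (M : R) (s : seq nat) :
  (forall n, 0 <= a n) -> (forall n, \sum_(0 <= k < n) a k <= M) ->
  uniq s -> \sum_(k <- s) a k <= M.
Proof.
move=> a0 aM us; set K := (\max_(k <- s) k).+1.
have -> : \sum_(k <- s) a k = \sum_(0 <= k < K | k \in s) a k.
  rewrite -[RHS]big_filter; apply: perm_big; apply: uniq_perm => //.
    by rewrite filter_uniq// iota_uniq.
  move=> k; rewrite mem_filter mem_index_iota leq0n/= ltnS.
  by have [ks|//] := boolP (k \in s); rewrite leq_bigmax_seq.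
apply: le_trans (aM K).
by rewrite big_mkcond/=; apply: ler_sum => k _; case: ifP.
Qed.

(** * The real inner product and Cauchy-Schwarz *)

Section HilbertFrames.
Context (R : realType) (H : completeNormedModType R[i]).
Context (dot : {dot H for Num.conj}).
Context (dot_norm : induces_norm dot).
Implicit Types (x y : H) (h : nat -> H).

(** The underlying real inner product, which induces the same norm; quadratic estimates then take
    place in [R]. *)
Definition rdot x y : R := complex.Re (dot x y).

Lemma dotC x y : dot x y = Num.conj (dot y x).
Proof. by rewrite hermC expr0 mul1r. Qed.

Lemma rnorm_dotC x y : rnorm (dot x y) = rnorm (dot y x).
Proof. by rewrite dotC rnorm_conj. Qed.

Lemma rdotC x y : rdot x y = rdot y x.
Proof. by rewrite /rdot dotC Re_conj. Qed.

Lemma rdotDl x y z : rdot (x + y) z = rdot x z + rdot y z.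
Proof. by rewrite /rdot linearDl raddfD. Qed.

Lemma rdotNl x y : rdot (- x) y = - rdot x y.
Proof. by rewrite /rdot linearNl raddfN. Qed.

Lemma rdotZl (a : R) x y : rdot (a%:C *: x) y = a * rdot x y.
Proof. by rewrite /rdot linearZl_LR/= ReMr. Qed.

Lemma rdotxx x : rdot x x = rnorm x ^+ 2.
Proof.
by apply: complexI; rewrite rmorphXn/= -normE /rdot -dot_norm RRe_real//.
Qed.

Lemma rnormDZ_sqr x y (a : R) :
  rnorm (x + a%:C *: y) ^+ 2 =
  rnorm x ^+ 2 + 2 * a * rdot x y + a ^+ 2 * rnorm y ^+ 2.
Proof.
rewrite -!rdotxx rdotDl rdotZl !(rdotC _ (_ + _)) !rdotDl !rdotZl (rdotC y x).
ring.
Qed.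

(** Cauchy-Schwarz: [y] is rescaled to the length of [x], and the squared norm of the difference is
    nonnegative. *)
Lemma rdot_le x y : rdot x y <= rnorm x * rnorm y.
Proof.
have [y0|y0] := eqVneq (rnorm y) 0.
  rewrite (rnorm_eq0 y0) rnorm0 mulr0 /rdot.
  by rewrite linear0r.
have yp : 0 < rnorm y by rewrite lt_neqAle eq_sym y0 rnorm_ge0.
have [x0|x0] := eqVneq (rnorm x) 0.
  have -> : x = 0 by exact: rnorm_eq0.
  by rewrite /rdot linear0l rnorm0 mul0r.
have xp : 0 < rnorm x by rewrite lt_neqAle eq_sym x0 rnorm_ge0.
have := sqr_ge0 (rnorm (x + (- (rnorm x / rnorm y))%:C *: y)).
rewrite rnormDZ_sqr.
have -> : rnorm x ^+ 2 + 2 * - (rnorm x / rnorm y) * rdot x y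
    + (- (rnorm x / rnorm y)) ^+ 2 * rnorm y ^+ 2 =
    (2 * (rnorm x / rnorm y)) * (rnorm x * rnorm y - rdot x y) by field.
by rewrite pmulr_rge0 ?subr_ge0// mulr_gt0// divr_gt0.
Qed.

Definition coef_sqr h x (n : nat) : R := rnorm (dot x (h n)) ^+ 2.

Lemma coef_sqr_ge0 h x n : 0 <= coef_sqr h x n.
Proof. exact: sqr_ge0. Qed.

(* The upper bound may always be enlarged, which makes it exceed the lower one. *)
Lemma frame_bounds h : frame dot h ->
  exists A B : R, [/\ 0 < A, A < B,
    forall x n, \sum_(0 <= k < n) coef_sqr h x k <= B * rnorm x ^+ 2
  & forall x M, (forall n, \sum_(0 <= k < n) coef_sqr h x k <= M) ->
      A * rnorm x ^+ 2 <= M].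
Proof.
move=> [A [B [A0 B0 AB]]]; exists A, (A + B); split => //.
- by rewrite ltrDl.
- move=> x n; have [_ le] := AB x.
  apply: (@le_trans _ _ (B * rnorm x ^+ 2)); last first.
    by rewrite mulrDl lerDr mulr_ge0 ?sqr_ge0 ?ltW.
  rewrite -lee_fin -sumEFin; apply: le_trans le.
  by apply: nneseries_lim_ge => k _ _; rewrite lee_fin sqr_ge0.
- move=> x M xM; have [le _] := AB x.
  rewrite -lee_fin; apply: (le_trans le).
  apply: lime_le.
    by apply: is_cvg_nneseries => k _ _; rewrite lee_fin sqr_ge0.
  by apply: nearW => n; rewrite sumEFin lee_fin; exact: xM.
Qed.

(** * Bessel sequences and their synthesis *)

Section Bessel.
Context (h : nat -> H) (B : R).
Context (B0 : 0 < B).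
Context (besselB :
  forall x n, \sum_(0 <= k < n) coef_sqr h x k <= B * rnorm x ^+ 2).

(** Duality: pairing the sum [v] with itself brings in the coefficients of [v], which Bessel's
    inequality controls. Duplicate-free lists cover permuted partial sums. *)
Lemma bessel_synthesis (c : nat -> R[i]) (s : seq nat) : uniq s ->
  rnorm (\sum_(k <- s) c k *: h k) ^+ 2 <= B * \sum_(k <- s) rnorm (c k) ^+ 2.
Proof.
move=> us; set v := \sum_(k <- s) _.
have vE : rnorm v ^+ 2 = \sum_(k <- s) complex.Re (c k * dot (h k) v).
  rewrite -rdotxx {1}/v; elim: (s) => [|k r ih].
    by rewrite !big_nil /rdot linear0l.
  by rewrite !big_cons rdotDl ih /rdot linearZl_LR.
(* Young's inequality: [2 c d <= B c^2 + d^2 / B] *)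
have : 2 * rnorm v ^+ 2 <=
    B * (\sum_(k <- s) rnorm (c k) ^+ 2) + B^-1 * \sum_(k <- s) coef_sqr h v k.
  rewrite vE !mulr_sumr -big_split/=; apply: ler_sum => k _.
  apply: (@le_trans _ _ (2 * (rnorm (c k) * rnorm (dot v (h k))))).
    by rewrite ler_pM2l// -[in leRHS]rnorm_dotC -rnormM Re_le_rnorm.
  rewrite /coef_sqr -subr_ge0.
  set p := rnorm (c k); set q := rnorm (dot _ _).
  have -> : B * p ^+ 2 + B^-1 * q ^+ 2 - 2 * (p * q) = B^-1 * (B * p - q) ^+ 2.
    by field; rewrite gt_eqF.
  by rewrite mulr_ge0 ?sqr_ge0 ?invr_ge0 ?ltW.
(* Bessel's inequality at [v] itself, so that this term is absorbed by the left-hand side. *)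
have : B^-1 * \sum_(k <- s) coef_sqr h v k <= rnorm v ^+ 2.
  rewrite mulrC ler_pdivrMr// mulrC.
  exact: (ler_sum_uniq (coef_sqr_ge0 h v) (besselB v)).
by move=> /[swap] le1 le2; lra.
Qed.

Lemma bessel_perm x (s : nat -> nat) n : injective s ->
  \sum_(0 <= k < n) coef_sqr h x (s k) <= B * rnorm x ^+ 2.
Proof.
move=> si; rewrite -(big_map s predT).
apply: (ler_sum_uniq (coef_sqr_ge0 h x) (besselB x)).
by rewrite map_inj_uniq// iota_uniq.
Qed.

Lemma bessel_synthesis_perm x (s : nat -> nat) m n : injective s ->
  rnorm (\sum_(m <= k < n) dot x (h (s k)) *: h (s k)) ^+ 2
    <= B * \sum_(m <= k < n) coef_sqr h x (s k).
Proof.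
move=> si.
have := @bessel_synthesis (fun k => dot x (h k)) (map s (index_iota m n)).
by rewrite !big_map; apply; rewrite map_inj_uniq// iota_uniq.
Qed.

(** The Bessel and synthesis bounds make the partial sums Cauchy; completeness gives the limit,
    which inherits linearity. *)
Lemma frame_operator_exists :
  exists S : {linear H -> H}, forall x,
    series (fun n => dot x (h n) *: h n) @ \oo --> S x.
Proof.
pose u x n := dot x (h n) *: h n.
have uS x : series (u x) @ \oo --> limn (series (u x)).
  apply: (@cvgn_series_le_sqr _ _ _ (coef_sqr h x) (B * rnorm x ^+ 2) B).
  - exact: coef_sqr_ge0.
  - exact: besselB.
  - by move=> m n; apply: (@bessel_synthesis_perm x id).
pose S x := limn (series (u x)).
have linS : linear S.
  move=> a x y; apply: (cvg_lim (@norm_hausdorff _ _)).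
  rewrite (_ : series _ = (a \*: series (u x)) \+ series (u y)).
    by apply: cvgD; [apply: cvgZl_tmp; exact: uS|exact: uS].
  apply/funext => n; rewrite /series/= scaler_sumr -big_split/=.
  apply: eq_bigr => k _.
  by rewrite /u linearDl linearZl_LR/= scalerDl scalerA.
pose L : {linear H -> H} := HB.pack S (GRing.isLinear.Build _ _ _ _ S linS).
by exists L.
Qed.

(** * The frame operator and its invertibility *)

Context (S : {linear H -> H}).
Context (SE : forall x, series (fun n => dot x (h n) *: h n) @ \oo --> S x).

(** The synthesis and Bessel bounds each contribute a factor [B] to the squared norm. *)
Lemma rnorm_frame_operator x : rnorm (S x) <= B * rnorm x.
Proof.
apply: (rnorm_lim_le (@SE x)) => n.
rewrite -(@ler_pXn2r _ 2)// ?nnegrE ?rnorm_ge0 ?mulr_ge0 ?rnorm_ge0 ?(ltW B0)//.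
apply: (@le_trans _ _ (B * \sum_(0 <= k < n) coef_sqr h x k)).
  exact: (@bessel_synthesis_perm x id).
by rewrite exprMn exprS -mulrA ler_pM2l// expr1 besselB.
Qed.

(** Pairing the partial sums of the series for [S x] with [x] gives the sums on the left, which
    increase to their limit. The lower frame bound takes such upper bounds as input. *)
Lemma coef_sqr_le_rdot x n : \sum_(0 <= k < n) coef_sqr h x k <= rdot (S x) x.
Proof.
pose P m := series (fun n => dot x (h n) *: h n) m.
have PE m : rdot (P m) x = \sum_(0 <= k < m) coef_sqr h x k.
  rewrite /P /series/=; elim: m => [|m ih].
    by rewrite !big_geq// /rdot linear0l.
  rewrite !big_nat_recr//= rdotDl ih; congr (_ + _).
  rewrite /rdot linearZl_LR/= (dotC (h m)) -normCK normE -rmorphXn.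
  by [].
apply/ler_addgt0Pr => e e0.
(* Adding 1 keeps the divisor positive when [x] is 0. *)
have K0 : 0 < rnorm x + 1 by rewrite ltr_wpDl ?rnorm_ge0.
have /(cvgn_rnormP _ _).1 := @SE x.
move=> /(_ _ (divr_gt0 e0 K0)) [m _ Pm].
have {}Pm := Pm (maxn m n) (leq_maxl _ _).
apply: (@le_trans _ _ (rdot (P (maxn m n)) x)).
  rewrite PE (big_cat_nat (leq0n n) (leq_maxr m n))/= lerDl.
  by apply: sumr_ge0 => k _; exact: sqr_ge0.
rewrite -lerBlDl.
have -> : rdot (P (maxn m n)) x - rdot (S x) x =
    rdot (P (maxn m n) - S x) x.
  by rewrite rdotDl rdotNl.
apply: (le_trans (rdot_le _ _)).
rewrite -rnormN opprB.
apply: (@le_trans _ _ (e / (rnorm x + 1) * (rnorm x + 1))).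
  by rewrite ler_pM ?rnorm_ge0// ?ltW// ltrDl.
by rewrite divfK// gt_eqF.
Qed.

Context (A : R) (A0 : 0 < A) (AB : A < B).
Context (lowerA : forall x M,
  (forall n, \sum_(0 <= k < n) coef_sqr h x k <= M) -> A * rnorm x ^+ 2 <= M).

Lemma frame_operator_coercive x : A * rnorm x ^+ 2 <= rdot (S x) x.
Proof. exact: lowerA (coef_sqr_le_rdot x). Qed.

(** Coercivity and Cauchy-Schwarz, divided by [rnorm x]. Norms can thus be estimated after applying
    [S]. *)
Lemma frame_operator_bounded_below x : A * rnorm x <= rnorm (S x).
Proof.
have [x0|x0] := eqVneq (rnorm x) 0; first by rewrite x0 mulr0 rnorm_ge0.
have xp : 0 < rnorm x by rewrite lt_neqAle eq_sym x0 rnorm_ge0.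
rewrite -(ler_pM2r xp) -mulrA -expr2.
exact: le_trans (frame_operator_coercive x) (rdot_le _ _).
Qed.

(* The step [A / B^2] minimizes the bound [1 - 2 t A + t^2 B^2] on the squared
   norm of [x |-> x - t S x]. *)
Lemma frame_operator_contraction :
  exists t q : R, [/\ t != 0, 0 <= q < 1 &
    forall x, rnorm (x - t%:C *: S x) <= q * rnorm x].
Proof.
have Bn0 : B != 0 by rewrite gt_eqF.
(* Value of the bound at the minimizing step; [A < B] makes it nonnegative and [0 < A] makes it less
   than 1. *)
pose q2 := 1 - (A / B) ^+ 2.
have q20 : 0 <= q2.
  rewrite subr_ge0 expr_le1// ?divr_ge0 ?ltW//.
  by rewrite ltr_pdivrMr// mul1r.
have q21 : q2 < 1 by rewrite ltrBlDr ltrDl exprn_gt0// divr_gt0.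
exists (A / B ^+ 2), (Num.sqrt q2); split.
- by rewrite gt_eqF// divr_gt0// exprn_gt0.
- by rewrite sqrtr_ge0 -sqrtr1 ltr_sqrt.
- move=> x.
  rewrite -(@ler_pXn2r _ 2)// ?nnegrE ?rnorm_ge0 ?mulr_ge0 ?sqrtr_ge0 ?rnorm_ge0//.
  rewrite exprMn sqr_sqrtr// -scaleNr -rmorphN rnormDZ_sqr rdotC.
  set t := A / B ^+ 2.
  have t0 : 0 < t by rewrite divr_gt0// exprn_gt0.
  have le1 : t * (A * rnorm x ^+ 2) <= t * rdot (S x) x.
    by rewrite ler_pM2l// frame_operator_coercive.
  have le2 : t ^+ 2 * rnorm (S x) ^+ 2 <= t ^+ 2 * (B * rnorm x) ^+ 2.
    rewrite ler_pM2l ?exprn_gt0//.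
    rewrite ler_pXn2r// ?nnegrE ?rnorm_ge0 ?rnorm_frame_operator//.
    by rewrite mulr_ge0 ?rnorm_ge0 ?ltW.
  have -> : q2 * rnorm x ^+ 2 =
      rnorm x ^+ 2 - 2 * (t * (A * rnorm x ^+ 2)) + t ^+ 2 * (B * rnorm x) ^+ 2.
    by rewrite /q2 /t; field.
  rewrite sqrrN; lra.
Qed.

(* The partial sums [x_n] of the residuals [r_k = (1 - t S)^k y] satisfy
   [t S x_n = y - r_n], by telescoping. *)
Lemma frame_operator_surjective y : exists x, S x = y.
Proof.
have [t [q [t0 /andP[q0 q1] Tq]]] := frame_operator_contraction.
pose T x := x - t%:C *: S x; pose r k := iter k T y.
have rq k : rnorm (r k) <= q ^+ k * rnorm y.
  elim: k => [|k ih]; first by rewrite expr0 mul1r.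
  by rewrite exprS -mulrA (le_trans (Tq _))// ler_wpM2l.
have q1' : 0 < 1 - q by rewrite subr_gt0.
have geoE n : (1 - q) * \sum_(0 <= k < n) q ^+ k = 1 - q ^+ n.
  by rewrite big_mkord -(opprB (q ^+ n)) subrX1 -mulNr opprB.
have geo n : \sum_(0 <= k < n) q ^+ k <= (1 - q)^-1.
  by rewrite -[leRHS]mul1r ler_pdivlMr// mulrC geoE gerBl exprn_ge0.
have geo2 m n : \sum_(m <= k < n) q ^+ k <= (1 - q)^-1.
  apply: (ler_sum_uniq _ geo); last exact: iota_uniq.
  by move=> k; exact: exprn_ge0.
have cr : cvgn (series r).
  (* Of the two geometric sums in the squared bound, one is at most [(1 - q)^-1], which leaves the
     linear bound that the criterion asks for. *)
  apply: (@cvgn_series_le_sqr _ _ _ (GRing.exp q) (1 - q)^-1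
            (rnorm y ^+ 2 * (1 - q)^-1)) => //.
    by move=> k; exact: exprn_ge0.
  move=> m n; set G := \sum_(m <= k < n) q ^+ k.
  have G0 : 0 <= G by apply: sumr_ge0 => k _; exact: exprn_ge0.
  apply: (@le_trans _ _ ((G * rnorm y) ^+ 2)).
    rewrite ler_pXn2r// ?nnegrE ?rnorm_ge0 ?mulr_ge0 ?rnorm_ge0//.
    rewrite (le_trans (rnorm_sum _ _))// mulr_suml; exact: ler_sum.
  rewrite exprMn mulrC -mulrA ler_wpM2l ?sqr_ge0// expr2 ler_wpM2r//.
  exact: geo2.
pose x := limn (series r).
have SrE n : t%:C *: S (series r n) = y - r n.
  rewrite /series/=; elim: n => [|n ih].
    by rewrite big_geq// linear0 scaler0 subrr.
  rewrite big_nat_recr//= linearD scalerDr ih /T opprB.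
  by rewrite -/(r n) addrA addrAC.
exists (t%:C *: x); rewrite linearZ/=.
have Sx : (fun n => t%:C *: S (series r n)) @ \oo --> t%:C *: S x.
  apply: cvgZl_tmp; apply/cvgn_rnormP => e e0.
  have /(cvgn_rnormP _ _).1/(_ _ (divr_gt0 e0 B0)) := cr.
  apply: filterS => n; rewrite ltr_pdivlMr// mulrC => /le_lt_trans; apply.
  by rewrite -linearB rnorm_frame_operator.
(* The residuals are the terms of a convergent series, so they tend to 0. *)
have Sy : (fun n => t%:C *: S (series r n)) @ \oo --> y.
  rewrite (_ : (fun n => _) = fun n => y - r n); last exact/funext.
  rewrite -[X in _ --> X]subr0; apply: cvgB; first exact: cvg_cst.
  exact: cvg_series_cvg_0.
by rewrite -(cvg_lim (@norm_hausdorff _ _) Sx) (cvg_lim (@norm_hausdorff _ _) Sy).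
Qed.

End Bessel.

(** Each [g n] is a preimage of [h n] under the frame operator [S]. Applying [S] turns sums of the
    [g n] into sums of the [h n], and the lower bound on [S] carries the estimates back. *)
Lemma frame_dual h : frame dot h ->
  exists g : nat -> H, forall x,
    unconditionally_convergent (fun n => dot x (h n) *: g n) /\
    series (fun n => dot x (h n) *: g n) @ \oo --> x.
Proof.
move=> /frame_bounds [A [B [A0 AB hB hA]]].
have B0 : 0 < B by exact: lt_trans AB.
have [S SE] := frame_operator_exists B0 hB.
have bel x : rnorm x <= A^-1 * rnorm (S x).
  by rewrite mulrC ler_pdivlMr// mulrC (frame_operator_bounded_below SE hA).
have /choice[g Sg] : forall n, exists x, S x = h n.
  by move=> n; apply: (frame_operator_surjective B0 hB SE A0 AB hA).
exists g => x; split.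
  move=> s /bij_inj si.
  apply: (@cvgn_series_le_sqr _ _ _ (coef_sqr h x \o s) (B * rnorm x ^+ 2)
            (A^-1 ^+ 2 * B)).
  - by move=> n; exact: coef_sqr_ge0.
  - by move=> n; exact: bessel_perm.
  - move=> m n; rewrite -mulrA.
    apply: le_trans (_ : _ <= A^-1 ^+ 2 * _ ^+ 2) _; last first.
      apply: ler_wpM2l; first exact: sqr_ge0.
      exact: bessel_synthesis_perm.
    rewrite -exprMn ler_pXn2r// ?nnegrE ?mulr_ge0 ?rnorm_ge0 ?invr_ge0 ?(ltW A0)//.
    rewrite (le_trans (bel _))// linear_sum/=.
    by under eq_bigr do rewrite linearZ/= Sg.
(* [S] maps the reconstruction error to the error of the frame series, which tends to 0. *)
apply/cvgn_rnormP => e e0.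
have /(cvgn_rnormP _ _).1/(_ _ (mulr_gt0 A0 e0)) := @SE x.
apply: filterS => n Sn; apply: le_lt_trans (bel _) _.
rewrite mulrC ltr_pdivrMr// mulrC.
rewrite linearB /series/= linear_sum/=.
by under eq_bigr do rewrite linearZ/= Sg.
Qed.

End HilbertFrames.

Theorem proposition4p12 (R : realType) (H : completeNormedModType R[i])
    (dot : {dot H for Num.conj})
    (dot_norm : induces_norm dot)
    (H_separable : separable H)
    (H_infinite : ~ finite_dimensional H)
    (M2 : forall (m : nat -> R[i]) (phi psi : nat -> H),
      unconditionally_convergent_multiplier dot m phi psi ->
      invertible_operator (multiplier dot m phi psi) ->
      exists alpha beta : nat -> R[i],
        [/\ frame dot (fun n => alpha n *: phi n),
            frame dot (fun n => beta n *: psi n)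
          & forall n, alpha n * Num.conj (beta n) = m n]) :
  forall f : nat -> H,
    weighted_frame dot f <->
    exists g : nat -> H, forall x : H,
      unconditionally_convergent (fun n => dot x (f n) *: g n) /\
      series (fun n => dot x (f n) *: g n) @ \oo --> x.
Proof.
move=> f; split=> [[w [w0 /(frame_dual dot_norm) [g gP]]]|[g gP]].
  exists (fun n => (w n)%:C *: g n) => x; have := gP x.
  (* The weights are real, so conjugation fixes them and they move from [f] to [g]. *)
  suff -> : (fun n => dot x ((w n)%:C *: f n) *: g n) =
      (fun n => dot x (f n) *: ((w n)%:C *: g n)) by [].
  apply/funext => n.
  by rewrite linearZr_LR/= conj_Creal ?ger0_real ?ler0c ?ltW// scalerA mulrC.
have termE x : multiplier_term dot (fun=> 1) g f x =
    (fun n => dot x (f n) *: g n).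
  by apply/funext => n; rewrite /multiplier_term mul1r.
have multE : multiplier dot (fun=> 1) g f = id.
  apply/funext => x; rewrite /multiplier termE.
  (* Convergence makes [limn] the true limit rather than its default. *)
  exact: (cvg_lim (@norm_hausdorff _ _) (gP x).2).
have [||alpha [beta [_ [A [B [A0 B0 AB]]] ab]]] := M2 (fun=> 1) g f.
- by move=> x; rewrite termE; exact: (gP x).1.
- rewrite multE; split; first by [].
    by exists 1 => x; rewrite mul1r.
  by exists id.
have beta0 n : beta n != 0.
  apply/eqP => b0; have := ab n.
  by rewrite b0 rmorph0 mulr0 => /esym/eqP; rewrite oner_eq0.
exists (fun n => rnorm (beta n)); split.
  move=> n; rewrite lt_neqAle rnorm_ge0 andbT eq_sym.
  by apply: contra (beta0 n) => /eqP/rnorm_eq0 ->.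
exists A, B; split => // x.
(* Only the modulus of [beta n] enters the modulus of a coefficient, so the frame bounds persist. *)
have coefE n : rnorm (dot x ((rnorm (beta n))%:C *: f n)) =
    rnorm (dot x (beta n *: f n)).
  by rewrite !linearZr_LR/= !rnormM !rnorm_conj rnorm_real// rnorm_ge0.
under eq_eseriesr do rewrite coefE.
exact: AB.
Qed.
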